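(* Let $D$ be a linearly connected digraph with $\eta\ge2$ strong components $D_1,\ldots,D_\eta$, all nontrivial, listed so that every arc between different strong components goes from $D_i$ to $D_{i+1}$ for some $i\in\{1,\ldots,\eta-1\}$. Suppose that a graph $G$ is the limit of $\{C(D^m)\}_{m=1}^\infty$. Then $G$ is a union of (pairwise vertex-disjoint) complete graphs if and only if, for each $p=1,\ldots,\eta-1$, $\kappa_\eta$ divides $\kappa_p$ and $i-j\equiv i'-j'\pmod{\kappa_\eta}$ for any $(i,j),(i',j')\in I(D_{p,p+1})$.
   Context: All digraphs are finite and simple (no loops, no multiple arcs; a pair of opposite arcs is allowed). A strong component is trivial if it has exactly one vertex, and nontrivial otherwise. A digraph $D$ is linearly connected if it is weakly connected and its strong components can be listed as $D_1,\ldots,D_\eta$ so that every arc of $D$ joining two different strong components goes from $D_i$ to $D_{i+1}$ for some $i$. For a nontrivial strong component $D_i$, $\kappa_i$ denotes its index of imprimitivity (gcd of the lengths of its directed cycles) and $U^{(i)}_1,\ldots,U^{(i)}_{\kappa_i}$ its sets of imprimitivity: the partition of $V(D_i)$, indexed by $\mathbb{Z}_{\kappa_i}$, such that every arc of $D_i$ goes from $U^{(i)}_j$ to $U^{(i)}_{j+1}$ for some $j$ (indices modulo $\kappa_i$; the labelling is fixed). For $1\le p\le\eta-1$, $$I(D_{p,p+1})=\{(k,l)\mid (x,y)\text{ is an arc of }D\text{ for some }x\in U^{(p)}_k,\ y\in U^{(p+1)}_l\}.$$ $D^m$ is the digraph on $V(D)$ with an arc $(u,w)$ iff there is a directed walk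 of length $m$ from $u$ to $w$ in $D$. $C(D')$ is the simple graph on $V(D')$ in which distinct $u,w$ are adjacent iff some vertex $z$ has both $(u,z)$ and $(w,z)$ as arcs of $D'$. A graph sequence converges if it is eventually constant; the eventual value is its limit. *)

(* Defs.v *)
From HB Require Import structures.
From mathcomp Require Import all_boot all_order all_algebra.

Set Implicit Arguments.
Unset Strict Implicit.
Unset Printing Implicit Defensive.

(* A finite simple digraph is an irreflexive [e : rel T] on [T : finType]
   ([e x y] is the arc (x, y)); irreflexivity is assumed where needed. *)

Section Digraph.
Variables (T : finType) (e : rel T).

Definition weakly_connected : Prop :=
  forall x y : T, connect [rel u v | e u v || e v u] x y.

Definition strong_components : {set {set T}} :=
  equivalence_partition [rel x y | connect e x y && connect e y x] [set: T].

(* Components are numbered from 0: [D i] is D_(i+1). *)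
Definition linear_listing (eta : nat) (D : 'I_eta -> {set T}) : Prop :=
  [/\ injective D,
      [set D i | i : 'I_eta] = strong_components
    & forall (i j : 'I_eta) (x y : T), i != j ->
        x \in D i -> y \in D j -> e x y -> j = i.+1 :> nat].

Definition linearly_connected : Prop :=
  weakly_connected /\
  exists (eta : nat) (D : 'I_eta -> {set T}), linear_listing D.

Definition has_cycle_in (V : {set T}) (n : nat) : bool :=
  (0 < n) && [exists c : n.-tuple T, ucycleb e c && all [in V] c].

(* A directed cycle has no repeated vertex, so its length is at most #|T|. *)
Definition imprimitivity (V : {set T}) : nat :=
  \big[gcdn/0]_(n < #|T|.+1 | has_cycle_in V n) n.

(* The residues mod k are 'I_k, not 'Z_k ('Z_1 has two elements);
   [ordS j] is j + 1 mod k. *)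
Definition imprimitivity_sets (V : {set T})
    (U : 'I_(imprimitivity V) -> {set T}) : Prop :=
  [/\ injective U,
      partition [set U j | j : 'I_(imprimitivity V)] V
    & forall x y : T, x \in V -> y \in V -> e x y ->
        exists j, x \in U j /\ y \in U (ordS j)].

Definition arc_classes (k l : nat) (U : 'I_k -> {set T}) (W : 'I_l -> {set T}) :
    {set 'I_k * 'I_l} :=
  [set ij | [exists x in U ij.1, exists y in W ij.2, e x y]].

Definition digraph_power (m : nat) : rel T :=
  fun u w => [exists s : m.-tuple T, path e u s && (last u s == w)].

Definition competition_graph : rel T :=
  fun u w => (u != w) && [exists z, e u z && e w z].

End Digraph.

Definition graph_limit (T : finType) (s : nat -> rel T) (G : rel T) : Prop :=
  exists N : nat, forall m : nat, N <= m -> s m =2 G.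

(* Isolated vertices are the one-vertex complete graphs. *)
Definition union_of_complete_graphs (T : finType) (G : rel T) : Prop :=
  exists P : {set {set T}}, partition P [set: T] /\
    forall u w : T,
      G u w <-> u != w /\ exists2 B, B \in P & u \in B /\ w \in B.

(* Main.v *)
(* No vertex is a sink, so the graphs C(D^m) increase with m and their limit G
   joins u and w exactly when walks of a common length lead from u and w to a
   common vertex.  Hence G is a union of complete graphs iff this relation is
   transitive.  Let k be the period of the last component, which every vertex
   reaches.  There, two vertices of one set of imprimitivity are related,
   because k is a difference of closed walk lengths.  Transitivity thus forces
   all walks of length m from u into the last component to end, for each u, at
   the same index minus m modulo k; this residue is a potential increasing by 1
   along every arc.  Conversely, given such a potential, two vertices are
   related iff their potentials agree.  The potential exists iff k divides every
   period and, across each pair of consecutive components, the difference of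
   class indices along arcs is constant modulo k. *)
Require Import Defs.
From mathcomp Require Import all_boot all_order all_algebra.
From mathcomp Require Import zify ring.

Set Implicit Arguments.
Unset Strict Implicit.
Unset Printing Implicit Defensive.

Import GRing.Theory.

Lemma dvdzD (d m n : int) :
  (d %| m)%Z -> (d %| n)%Z -> (d %| (m + n)%R)%Z.
Proof. exact: rpredD. Qed.

Lemma dvdzB (d m n : int) :
  (d %| m)%Z -> (d %| n)%Z -> (d %| (m - n)%R)%Z.
Proof. exact: rpredB. Qed.

(** * Walks of fixed length and vertices that meet ahead *)

Section Walks.
Variables (T : finType) (e : rel T).
Implicit Types x y z u v w : T.

Lemma digraph_powerP m x y :
  reflect (exists s, [/\ size s = m, path e x s & last x s = y])
          (digraph_power e m x y).
Proof.
apply: (iffP existsP) => [[s /andP[es /eqP ls]]|[s [sz es ls]]].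
  by exists s; rewrite size_tuple.
by exists (tcast sz (in_tuple s)); rewrite val_tcast es ls /=.
Qed.

Lemma digraph_power0 x : digraph_power e 0 x x.
Proof. by apply/digraph_powerP; exists [::]. Qed.

Lemma digraph_power1 x y : e x y -> digraph_power e 1 x y.
Proof. by move=> exy; apply/digraph_powerP; exists [:: y]; rewrite /= exy. Qed.

Lemma digraph_powerD m n y x z :
  digraph_power e m x y -> digraph_power e n y z -> digraph_power e (m + n) x z.
Proof.
move=> /digraph_powerP[s [<- es <-]] /digraph_powerP[t [<- et <-]].
by apply/digraph_powerP; exists (s ++ t); rewrite size_cat cat_path es et last_cat.
Qed.

Lemma digraph_power_recl m x z :
  digraph_power e m.+1 x z -> exists2 y, e x y & digraph_power e m y z.
Proof.
case/digraph_powerP=> -[|y s] [] //= [sz] /andP[exy es] ls.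
by exists y => //; apply/digraph_powerP; exists s.
Qed.

Lemma connect_digraph_power x y :
  connect e x y <-> exists m, digraph_power e m x y.
Proof.
split=> [/connectP[s es ->]|[m /digraph_powerP[s [_ es <-]]]].
  by exists (size s); apply/digraph_powerP; exists s.
by apply/connectP; exists s.
Qed.

(** Equal vertices are allowed, which makes the relation reflexive; the limit graph is its
    restriction to distinct vertices. *)
Definition meet_ahead u w : Prop :=
  exists m z, digraph_power e m u z /\ digraph_power e m w z.

Lemma meet_ahead_refl u : meet_ahead u u.
Proof. by exists 0, u; split; apply: digraph_power0. Qed.

Lemma meet_ahead_sym u w : meet_ahead u w -> meet_ahead w u.
Proof. by case=> m [z [? ?]]; exists m, z. Qed.

Lemma meet_ahead_back n u w u' w' :
    digraph_power e n u u' -> digraph_power e n w w' ->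
  meet_ahead u' w' -> meet_ahead u w.
Proof.
move=> uu' ww' [m [z [uz wz]]]; exists (n + m), z.
by split; [apply: digraph_powerD uz | apply: digraph_powerD wz].
Qed.

Lemma digraph_power_total (V : {set T}) n x :
    (forall y, y \in V -> exists2 z, z \in V & e y z) ->
  x \in V -> exists2 z, z \in V & digraph_power e n x z.
Proof.
move=> outV; elim: n x => [|n IHn] x Vx; first by exists x => //; apply: digraph_power0.
have [y Vy exy] := outV x Vx; have [z Vz yz] := IHn y Vy.
by exists z => //; apply: digraph_powerD (digraph_power1 exy) yz.
Qed.

(** Without sinks, walks that meet after [m] steps can be prolonged together to length [m + N],
    where the graph sequence is already constant. *)
Lemma graph_limit_competition (G : rel T) u w :
    (forall y, exists z, e y z) ->
    graph_limit (fun m => competition_graph (digraph_power e m)) G ->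
  G u w <-> u != w /\ meet_ahead u w.
Proof.
move=> out [N limG]; split=> [|[neq [m [z [uz wz]]]]].
  rewrite -(limG N (leqnn N)) => /andP[neq /existsP[z /andP[uz wz]]].
  by split=> //; exists N, z.
have [||z' _ zz'] := @digraph_power_total setT N z; rewrite ?inE //.
  by move=> y _; have [y' eyy'] := out y; exists y'; rewrite ?inE.
rewrite -(limG (m + N) (leq_addl m N)) /competition_graph /= neq.
by apply/existsP; exists z'; rewrite !(digraph_powerD _ zz').
Qed.

Lemma digraph_power_potential (k : nat) (phi : T -> int) m x y :
    (forall x y, e x y -> (k%:Z %| (phi y - phi x - 1)%R)%Z) ->
  digraph_power e m x y -> (k%:Z %| (phi y - phi x - m%:Z)%R)%Z.
Proof.
move=> phi_arc; elim: m x => [|m IHm] x.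
  by case/digraph_powerP=> s [/size0nil-> _ <-]; rewrite subrr subr0.
case/digraph_power_recl=> z exz /IHm; move: (phi_arc _ _ exz) => d1 d2.
have -> : (phi y - phi x - m.+1%:Z =
           (phi y - phi z - m%:Z) + (phi z - phi x - 1))%R
  by rewrite -[m.+1]addn1 PoszD; ring.
exact: dvdzD.
Qed.

End Walks.

(** * Unions of complete graphs and equivalence relations *)

(** The cliques, singletons included, are the classes of [R], which is reflexive and symmetric by
    hypothesis; only transitivity is at stake. *)
Lemma union_of_complete_graphsP (T : finType) (G : rel T) (R : T -> T -> Prop) :
    (forall u, R u u) -> (forall u w, R u w -> R w u) ->
    (forall u w, G u w <-> u != w /\ R u w) ->
  union_of_complete_graphs G <-> (forall u v w, R u v -> R v w -> R u w).
Proof.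
move=> Rrefl Rsym GE; split=> [[P [partP GP]] u v w uv vw | Rtrans].
  have [-> //|neq_uv] := eqVneq u v; have [<- //|neq_vw] := eqVneq v w.
  have [<- //|neq_uw] := eqVneq u w.
  have /GP[_ [B PB [uB vB]]] : G u v by apply/GE.
  have /GP[_ [C PC [vC wC]]] : G v w by apply/GE.
  have tiP : trivIset P by case/and3P: partP.
  have eqBC : B = C by rewrite -(def_pblock tiP PB vB) (def_pblock tiP PC vC).
  suff /GE[] : G u w by [].
  by apply/GP; split=> //; exists B => //; rewrite eqBC in uB *.
(* [R] is a mere proposition, while a partition into classes needs a boolean relation; equality or
   [G] decides [R]. *)
pose S := [rel u w | (u == w) || G u w].
have SP u w : reflect (R u w) (S u w).
  apply: (iffP orP) => [[/eqP-> //|/GE[] //]|Ruw].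
  by have [->|neq] := eqVneq u w; [left | right; apply/GE].
have eqS : {in [set: T] & &, equivalence_rel S}.
  move=> u v w _ _ _; split; first exact/SP.
  move=> /SP uv; apply/SP/SP; [exact/Rtrans/Rsym | exact: Rtrans].
have partP := equivalence_partitionP eqS.
exists (equivalence_partition S [set: T]); split=> // u w.
have tiP := let: And3 _ t _ := and3P partP in t.
have covP := cover_partition partP.
split=> [/GE[neq Ruw]|[neq [B PB [uB wB]]]].
  split=> //; exists (pblock (equivalence_partition S [set: T]) u).
    by rewrite pblock_mem ?covP ?inE.
  by rewrite mem_pblock covP (pblock_equivalence_partition eqS) ?inE //; split=> //; apply/SP.
apply/GE; split=> //.
have := pblock_equivalence_partition eqS (in_setT u) (in_setT w).
by rewrite (def_pblock tiP PB uB) wB => /esym/SP.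
Qed.

(** * Class indices as residues *)

Lemma index_congr_eq (k : nat) (i j : 'I_k) :
  (k%:Z %| (i%:Z - j%:Z)%R)%Z -> i = j.
Proof.
rewrite -eqz_mod_dvd !modz_nat !modn_small // => /eqP[eq_ij].
exact: val_inj.
Qed.

Lemma exists_index_congr (k : nat) (c : int) :
  0 < k -> exists i : 'I_k, (k%:Z %| (c - i%:Z)%R)%Z.
Proof.
move=> k_gt0; have k_neq0 : (k%:Z != 0)%R by lia.
have c_ge0 := modz_ge0 c k_neq0.
have c_lt : (`|(c %% k%:Z)%Z| < k)%N
  by have := @ltz_pmod c (Posz k) k_gt0; lia.
exists (Ordinal c_lt); rewrite /= gez0_abs //.
by rewrite -eqz_mod_dvd modz_mod.
Qed.

(** * Walks inside a strong component *)

Section StrongComponent.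
Variables (T : finType) (e : rel T) (V : {set T}).
Hypothesis V_strong : V \in strong_components e.
Implicit Types x y z : T.

Lemma strong_equivalence :
  {in [set: T] & &, equivalence_rel [rel x y | connect e x y && connect e y x]}.
Proof.
move=> x y z _ _ _ /=; rewrite connect0; split=> // /andP[xy yx].
apply/andP/andP=> -[a b]; split.
- exact: connect_trans yx a.
- exact: connect_trans b xy.
- exact: connect_trans xy a.
- exact: connect_trans b yx.
Qed.

Lemma strong_components_partition : partition (strong_components e) [set: T].
Proof. exact: equivalence_partitionP strong_equivalence. Qed.

Lemma mem_strong x y : x \in V -> (y \in V) = connect e x y && connect e y x.
Proof.
move=> Vx; have /and3P[_ tiP _] := strong_components_partition.
rewrite -(def_pblock tiP V_strong Vx).
by rewrite (pblock_equivalence_partition strong_equivalence) ?inE.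
Qed.

Lemma strong_walk x y : x \in V -> y \in V -> exists m, digraph_power e m x y.
Proof.
by move=> Vx; rewrite (mem_strong _ Vx) => /andP[/connect_digraph_power].
Qed.

(** A walk to a second vertex of [V] has a first arc, whose head still reaches [V] and hence lies in
    it. *)
Lemma strong_out x : 1 < #|V| -> x \in V -> exists2 y, y \in V & e x y.
Proof.
move=> V_gt1 Vx.
have [z Vz neq] : exists2 z, z \in V & z != x.
  have /card_gt0P[z] : 0 < #|V :\ x| by move: V_gt1; rewrite (cardsD1 x) Vx.
  by rewrite !inE => /andP[neq Vz]; exists z.
have [m] := strong_walk Vx Vz.
case: m => [/digraph_powerP[s [/size0nil-> _ /= eq_xz]]|m].
  by rewrite eq_xz eqxx in neq.
case/digraph_power_recl=> y exy yz; exists y => //.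
rewrite (mem_strong _ Vx) connect1 //=.
apply: (connect_trans (y := z)); first by apply/connect_digraph_power; exists m.
by move: Vz; rewrite (mem_strong _ Vx) => /andP[].
Qed.

(** * The period as a difference of closed walk lengths *)

(** Closed walk lengths at [x] are closed under sums only; their differences are also closed under
    subtraction, hence under gcd. *)
Definition closed_walk_difference x n : Prop :=
  exists2 s, digraph_power e s x x & digraph_power e (s + n) x x.

Lemma closed_walk_differenceD x m n : closed_walk_difference x m ->
  closed_walk_difference x n -> closed_walk_difference x (m + n).
Proof.
move=> [s s1 s2] [t t1 t2]; exists (s + t); first exact: digraph_powerD t1.
by rewrite addnACA; apply: digraph_powerD t2.
Qed.

Lemma closed_walk_differenceMl x m n :
  closed_walk_difference x n -> closed_walk_difference x (m * n).
Proof.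
move=> dn; elim: m => [|m IHm]; last exact: closed_walk_differenceD.
by exists 0; apply: digraph_power0.
Qed.

(** Pairing crosswise, the closed walks of lengths [s + (n + m) + t] and [s + (t + n)] differ by
    [m]. *)
Lemma closed_walk_differenceB x m n : closed_walk_difference x (n + m) ->
  closed_walk_difference x n -> closed_walk_difference x m.
Proof.
move=> [s s1 s2] [t t1 t2]; exists (s + (t + n)); first exact: digraph_powerD t2.
have -> : s + (t + n) + m = (s + (n + m)) + t by lia.
exact: digraph_powerD t1.
Qed.

Lemma closed_walk_difference_gcd x m n : closed_walk_difference x m ->
  closed_walk_difference x n -> closed_walk_difference x (gcdn m n).
Proof.
case: m => [|m] dm dn; first by rewrite gcd0n.
(* Bezout in natural numbers: [a * m.+1 = b * n + gcdn m.+1 n]. *)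
have [a b eq_ab _] := @egcdnP m.+1 n (ltn0Sn m).
apply: (@closed_walk_differenceB _ _ (b * n)); last exact: closed_walk_differenceMl.
by rewrite -eq_ab; apply: closed_walk_differenceMl.
Qed.

Lemma cycle_closed_walk (c : seq T) :
  cycle e c -> {in c, forall y, digraph_power e (size c) y y}.
Proof.
move=> ec y cy; have [i s rot_c] := rot_to cy.
move: ec; rewrite -(rot_cycle i) rot_c /= => es.
apply/digraph_powerP; exists (rcons s y); rewrite last_rcons size_rcons; split=> //.
by rewrite -(size_rot i c) rot_c.
Qed.

Lemma has_cycle_in_closed_walk n :
  has_cycle_in e V n -> exists2 y, y \in V & digraph_power e n y y.
Proof.
case/andP=> n_gt0 /existsP[c /andP[/andP[ec _] /allP cV]].
have [y cy] : exists y, y \in tval c.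
  by case: c {ec cV} n_gt0 => -[|y s] /= /eqP <- // _; exists y; rewrite mem_head.
exists y; first exact: cV.
by have := cycle_closed_walk ec cy; rewrite size_tuple.
Qed.

(** Each cycle length is a difference at [x]: go from [x] to the cycle and back, with or without one
    turn around it. The gcd of these lengths is then a difference too. *)
Lemma imprimitivity_difference x :
  x \in V -> closed_walk_difference x (imprimitivity e V).
Proof.
move=> Vx; rewrite /imprimitivity.
apply: (big_ind (closed_walk_difference x)).
- by exists 0; apply: digraph_power0.
- exact: closed_walk_difference_gcd.
move=> n /has_cycle_in_closed_walk[y Vy yy].
have [a xy] := strong_walk Vx Vy; have [b yx] := strong_walk Vy Vx.
exists (a + b); first exact: digraph_powerD xy yx.
have -> : a + b + n = a + (n + b) by lia.
exact: digraph_powerD xy (digraph_powerD yy yx).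
Qed.

Lemma dvdn_imprimitivity k :
    (forall y m, y \in V -> digraph_power e m y y -> k %| m) ->
  k %| imprimitivity e V.
Proof.
move=> k_dvd; rewrite /imprimitivity.
apply: (big_ind (fun n => k %| n)) => [|m n km kn|n].
- exact: dvdn0.
- by rewrite dvdn_gcd km.
by case/has_cycle_in_closed_walk=> y; apply: k_dvd.
Qed.

(** * Sets of imprimitivity *)

Variable U : 'I_(imprimitivity e V) -> {set T}.
Hypothesis U_sets : imprimitivity_sets U.

Lemma imprimitivity_set_nonempty i : exists x, x \in U i.
Proof.
have [_ /and3P[_ _ n0] _] := U_sets.
by apply/set0Pn; apply: contraNneq n0 => <-; apply: imset_f.
Qed.

Lemma imprimitivity_set_sub i x : x \in U i -> x \in V.
Proof.
have [_ partU _] := U_sets => Ux; rewrite -(cover_partition partU).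
by apply/bigcupP; exists (U i) => //; apply: imset_f.
Qed.

Lemma imprimitivity_set_cover x : x \in V -> exists i, x \in U i.
Proof.
have [_ partU _] := U_sets => Vx; move: (Vx); rewrite -{1}(cover_partition partU).
by case/bigcupP=> _ /imsetP[i _ ->] Ux; exists i.
Qed.

Lemma imprimitivity_set_inj i j x : x \in U i -> x \in U j -> i = j.
Proof.
have [injU /and3P[_ tiU _] _] := U_sets => Ui Uj; apply: injU.
by rewrite -(def_pblock tiU _ Ui) ?imset_f // (def_pblock tiU _ Uj) ?imset_f.
Qed.

Lemma imprimitivity_set_walk m x y i j :
    x \in U i -> y \in U j -> digraph_power e m x y ->
  ((imprimitivity e V)%:Z %| (j%:Z - i%:Z - m%:Z)%R)%Z.
Proof.
elim: m x i => [|m IHm] x i Ux Uy.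
  case/digraph_powerP=> s [/size0nil-> _ /= eq_xy]; rewrite -eq_xy in Uy.
  by rewrite (imprimitivity_set_inj Ux Uy) subrr subr0.
case/digraph_power_recl=> z exz zy.
have Vx := imprimitivity_set_sub Ux; have Vy := imprimitivity_set_sub Uy.
(* The first vertex after [x] lies between two vertices of [V], so the walk never leaves the
   component. *)
have Vz : z \in V.
  rewrite (mem_strong _ Vx) connect1 //=; apply: (connect_trans (y := y)).
    by apply/connect_digraph_power; exists m.
  by move: Vy; rewrite (mem_strong _ Vx) => /andP[].
have [_ _ /(_ x z Vx Vz exz)[i' [Ux' Uz]]] := U_sets.
rewrite -{i' Ux'}(imprimitivity_set_inj Ux Ux') in Uz.
have d1 := IHm z _ Uz Uy zy.
(* [ordS] wraps around, so the index grows by 1 only modulo the period. *)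
have d2 : ((imprimitivity e V)%:Z %| ((ordS i)%:Z - i%:Z - 1)%R)%Z.
  rewrite /= -addrA -opprD -eqz_mod_dvd modz_nat.
  by rewrite -[(_ + 1)%R]/((i + 1)%N%:Z)%R modz_nat addn1 modn_mod.
have -> : (j%:Z - i%:Z - m.+1%:Z =
   (j%:Z - (ordS i)%:Z - m%:Z) + ((ordS i)%:Z - i%:Z - 1))%R
  by rewrite -[m.+1]addn1 PoszD; ring.
exact: dvdzD.
Qed.

(* The period is a difference of closed walk lengths at [x], which allows the
   two walks into [x] to be completed to a common length. *)
Lemma imprimitivity_set_meet_ahead i x y :
  x \in U i -> y \in U i -> meet_ahead e x y.
Proof.
move=> Ux Uy.
have Vx := imprimitivity_set_sub Ux; have Vy := imprimitivity_set_sub Uy.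
have [m yx] := strong_walk Vy Vx.
have := imprimitivity_set_walk Uy Ux yx.
rewrite subrr sub0r rpredN dvdzE !absz_nat => /dvdnP[a def_m].
have [s s1 s2] := closed_walk_differenceMl a (imprimitivity_difference Vx).
rewrite -def_m in s2; exists (m + s), x; split; first by rewrite addnC.
exact: digraph_powerD s1.
Qed.

(** * Potentials and transitivity, for a component reached from every vertex *)

Hypothesis V_gt1 : 1 < #|V|.
Hypothesis reach_V : forall x, exists2 z, z \in V & connect e x z.

Local Notation k := (imprimitivity e V).

Lemma walk_to_imprimitivity_set x :
  exists m i z, z \in U i /\ digraph_power e m x z.
Proof.
have [z Vz /connect_digraph_power[m xz]] := reach_V x.
by have [i Uz] := imprimitivity_set_cover Vz; exists m, i, z.
Qed.

Lemma walk_in_V m x :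
  x \in V -> exists i z, z \in U i /\ digraph_power e m x z.
Proof.
move=> Vx.
have [z Vz xz] := digraph_power_total m (fun y => @strong_out y V_gt1) Vx.
by have [i Uz] := imprimitivity_set_cover Vz; exists i, z.
Qed.

(** Any [w] in [V] of index congruent to [j - m] works: [m] steps inside [V] lead from [w] to index
    [j], the set that contains [z]. *)
Lemma meet_ahead_index m u z j :
    z \in U j -> digraph_power e m u z ->
  exists i w, [/\ w \in U i, (k%:Z %| (j%:Z - m%:Z - i%:Z)%R)%Z & meet_ahead e u w].
Proof.
move=> Uz uz; have k_gt0 : 0 < k by apply: leq_ltn_trans (ltn_ord j).
have [i d1] := exists_index_congr (j%:Z - m%:Z)%R k_gt0.
have [w Uw] := imprimitivity_set_nonempty i.
have [j' [z' [Uz' wz']]] := walk_in_V m (imprimitivity_set_sub Uw).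
exists i, w; split=> //; apply: (meet_ahead_back uz wz').
suff eq_j : j = j' by rewrite -eq_j in Uz'; apply: imprimitivity_set_meet_ahead Uz Uz'.
apply: index_congr_eq; have d2 := imprimitivity_set_walk Uw Uz' wz'.
have -> : (j%:Z - j'%:Z =
  (j%:Z - m%:Z - i%:Z) - (j'%:Z - i%:Z - m%:Z))%R by ring.
exact: dvdzB.
Qed.

(** Once the meeting point is led on into [V], the two walks have the same length and the same end,
    which determines the index of their starts. *)
Lemma meet_ahead_same_index x y i j :
  x \in U i -> y \in U j -> meet_ahead e x y -> i = j.
Proof.
move=> Ux Uy [m [z [xz yz]]].
have [n [l [v [Uv zv]]]] := walk_to_imprimitivity_set z.
have d1 := imprimitivity_set_walk Ux Uv (digraph_powerD xz zv).
have d2 := imprimitivity_set_walk Uy Uv (digraph_powerD yz zv).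
apply: index_congr_eq; have -> : (i%:Z - j%:Z =
  (l%:Z - j%:Z - (m + n)%:Z) - (l%:Z - i%:Z - (m + n)%:Z))%R by rewrite PoszD; ring.
exact: dvdzB.
Qed.

(** A homomorphism to the directed cycle of residues modulo [k], with integer representatives as
    values. *)
Definition potential (phi : T -> int) : Prop :=
  forall x y, e x y -> (k%:Z %| (phi y - phi x - 1)%R)%Z.

Lemma meet_ahead_potential phi u w :
  potential phi -> meet_ahead e u w <-> (k%:Z %| (phi u - phi w)%R)%Z.
Proof.
move=> phi_arc; have phi_walk := digraph_power_potential phi_arc.
split=> [[m [z [uz wz]]]|d_uw].
  have -> : (phi u - phi w =
    (phi z - phi w - m%:Z) - (phi z - phi u - m%:Z))%R by ring.
  by apply: dvdzB; apply: phi_walk.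
have [m [_ [z [/imprimitivity_set_sub Vz uz]]]] := walk_to_imprimitivity_set u.
have [n [_ [v [/imprimitivity_set_sub Vv wv]]]] := walk_to_imprimitivity_set w.
(* Walking [n] more steps from [z] and [m] more from [v] gives both walks the length [m + n]. *)
have [i [z' [Uz' zz']]] := walk_in_V n Vz.
have [j [v' [Uv' vv']]] := walk_in_V m Vv.
have uz' := digraph_powerD uz zz'.
have wv' := digraph_powerD wv vv'; rewrite addnC in wv'.
apply: (meet_ahead_back uz' wv').
suff eq_ij : i = j by rewrite -eq_ij in Uv'; apply: imprimitivity_set_meet_ahead Uz' Uv'.
(* Along a walk from [z'] to [v'] the potential and the class index both grow by [l] modulo [k], so
   equal potentials force equal indices. *)
have [l zv'] := strong_walk (imprimitivity_set_sub Uz') (imprimitivity_set_sub Uv').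
have d1 := imprimitivity_set_walk Uz' Uv' zv'.
have d2 := phi_walk _ _ _ zv'.
have d3 := phi_walk _ _ _ uz'.
have d4 := phi_walk _ _ _ wv'.
apply: index_congr_eq.
have -> : (i%:Z - j%:Z = (phi v' - phi z' - l%:Z) - (j%:Z - i%:Z - l%:Z)
   + (phi z' - phi u - (m + n)%:Z) - (phi v' - phi w - (m + n)%:Z)
   + (phi u - phi w))%R by rewrite PoszD; ring.
exact: (dvdzD (dvdzB (dvdzD (dvdzB d2 d1) d3) d4) d_uw).
Qed.

(** Under transitivity, the vertices of [V] related to [u] all lie in one set of imprimitivity; its
    index serves as the potential of [u]. *)
Lemma meet_ahead_trans_potential :
  (forall u v w, meet_ahead e u v -> meet_ahead e v w -> meet_ahead e u w) <->
  exists phi, potential phi.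
Proof.
split=> [meet_trans|[phi phi_arc] u v w]; last first.
  rewrite !(meet_ahead_potential _ _ phi_arc) => d1 d2.
  have -> : (phi u - phi w = (phi u - phi v) + (phi v - phi w))%R by ring.
  exact: dvdzD.
have /fin_all_exists[phi phiP] : forall u, exists a : int, forall m z j,
    z \in U j -> digraph_power e m u z -> (k%:Z %| (j%:Z - m%:Z - a)%R)%Z.
  move=> u.
  have [m0 [j0 [z0 [Uz0 uz0]]]] := walk_to_imprimitivity_set u.
  have [i0 [w0 [Uw0 _ uw0]]] := meet_ahead_index Uz0 uz0.
  exists (i0%:Z)%R => m z j Uz uz.
  have [i [w [Uw d uw]]] := meet_ahead_index Uz uz.
  have ww0 := meet_trans _ _ _ (meet_ahead_sym uw) uw0.
  by rewrite -(meet_ahead_same_index Uw Uw0 ww0).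
(* A walk of length [m] from [y] and its extension by the arc, of length [1 + m] from [x], share the
   end [z]; comparing them gives the increment 1. *)
exists phi => x y exy; have [m [j [z [Uz yz]]]] := walk_to_imprimitivity_set y.
have d1 := phiP _ _ _ _ Uz yz.
have d2 := phiP _ _ _ _ Uz (digraph_powerD (digraph_power1 exy) yz).
have -> : (phi y - phi x - 1 =
  (j%:Z - (1 + m)%:Z - phi x) - (j%:Z - m%:Z - phi y))%R by rewrite PoszD; ring.
exact: dvdzB.
Qed.

End StrongComponent.

(** * The linear order of the components *)

Section LinearListing.
Variables (T : finType) (e : rel T) (eta : nat) (D : 'I_eta -> {set T}).
Hypotheses (e_weak : weakly_connected e) (D_list : linear_listing e D).
Implicit Types (x y z : T) (p q : 'I_eta).

Lemma listing_strong p : D p \in strong_components e.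
Proof. by have [_ <- _] := D_list; apply: imset_f. Qed.

Lemma listing_cover x : exists p, x \in D p.
Proof.
have : x \in cover (strong_components e).
  by rewrite (cover_partition (strong_components_partition e)) inE.
have [_ <- _] := D_list.
by case/bigcupP=> _ /imsetP[p _ ->]; exists p.
Qed.

Lemma listing_inj p q x : x \in D p -> x \in D q -> p = q.
Proof.
have [injD _ _] := D_list => Dp Dq; apply: injD.
have /and3P[_ tiD _] := strong_components_partition e.
by rewrite -(def_pblock tiD (listing_strong p) Dp) (def_pblock tiD (listing_strong q) Dq).
Qed.

Lemma listing_nonempty p : exists x, x \in D p.
Proof.
have /and3P[_ _ n0] := strong_components_partition e.
by apply/set0Pn; apply: contraNneq n0 => <-; apply: listing_strong.
Qed.

Lemma listing_arc x y p q : x \in D p -> y \in D q -> e x y ->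
  p = q \/ q = p.+1 :> nat.
Proof.
have [_ _ D_arc] := D_list => Dx Dy exy.
by have [|neq] := eqVneq p q; [left | right; apply: D_arc exy].
Qed.

(** Weak connectivity enters here: without such an arc, no arc would join the union [A] of the
    components up to [p] to its complement, which contains [D q]. *)
Lemma listing_succ_arc p q : q = p.+1 :> nat ->
  exists x y, [/\ x \in D p, y \in D q & e x y].
Proof.
move=> q_succ.
have [/existsP[x /existsP[y /and3P[Dx Dy exy]]]|no_arc] :=
  boolP [exists x, exists y, [&& x \in D p, y \in D q & e x y]].
  by exists x, y.
pose A := [set x | [exists i : 'I_eta, (i <= p) && (x \in D i)]].
have inA x i : x \in D i -> (x \in A) = (i <= p).
  move=> Dx; rewrite inE; apply/existsP/idP => [[j /andP[le_jp Dj]]|le_ip].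
    by rewrite (listing_inj Dx Dj).
  by exists i; rewrite le_ip.
have closA x y : e x y -> (x \in A) = (y \in A).
  move=> exy; have [i Dx] := listing_cover x; have [j Dy] := listing_cover y.
  rewrite (inA _ _ Dx) (inA _ _ Dy).
  have [-> //|j_succ] := listing_arc Dx Dy exy.
  (* An arc from [D i] to the next component can leave [A] only if [i = p], and then it would end in
     [D q]. *)
  rewrite j_succ leq_eqVlt; have [eq_ip|//] := eqVneq (i : nat) p.
  case/negP: no_arc; apply/existsP; exists x; apply/existsP; exists y.
  have <- : i = p by apply: val_inj.
  have <- : j = q by apply: val_inj; rewrite /= j_succ q_succ eq_ip.
  by rewrite Dx Dy.
have [a Da] := listing_nonempty p; have [b Db] := listing_nonempty q.
have closA2 : closed [rel u v | e u v || e v u] A.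
  by move=> x y /orP[/closA|/closA /esym].
have := closed_connect closA2 (e_weak a b).
by rewrite (inA _ _ Da) (inA _ _ Db) leqnn q_succ ltnn.
Qed.

(** Induction on the distance [r - p]: move inside [D p] to the tail of an arc into the next
    component, and follow it. *)
Lemma listing_reach_last (r : 'I_eta) x :
  r.+1 = eta -> exists2 z, z \in D r & connect e x z.
Proof.
move=> r_last; have [p Dx] := listing_cover x.
have [n le_n] := ubnP (r - p); elim: n => // n IHn in p x Dx le_n *.
have [eq_pr|lt_pr] : (p = r) \/ (p < r).
  have [->|neq] := eqVneq p r; [by left | right].
    by rewrite ltn_neqAle neq -ltnS r_last ltn_ord.
  by exists x; rewrite // -eq_pr.
have lt_p1 : p.+1 < eta by move: lt_pr; rewrite -ltnS r_last.
have [y [z [Dy Dz eyz]]] := @listing_succ_arc p (Ordinal lt_p1) erefl.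
have [|t Dt zt] := IHn _ _ Dz; first by rewrite /=; lia.
exists t => //; apply: connect_trans zt; apply: connect_trans (connect1 eyz).
by move: Dy; rewrite (mem_strong (listing_strong p) _ Dx) => /andP[].
Qed.

(** * Potentials and arcs between consecutive components *)

Variable U : forall p : 'I_eta, 'I_(imprimitivity e (D p)) -> {set T}.
Hypothesis U_sets : forall p : 'I_eta, imprimitivity_sets (@U p).
Variable r : 'I_eta.
Hypothesis r_last : r.+1 = eta.

Local Notation k := (imprimitivity e (D r)).

Lemma arc_classesP p q (i : 'I_(imprimitivity e (D p)))
    (j : 'I_(imprimitivity e (D q))) :
  reflect (exists x y, [/\ x \in U i, y \in U j & e x y])
          ((i, j) \in arc_classes e (@U p) (@U q)).
Proof.
rewrite inE; apply: (iffP exists_inP) => [[x Ux /exists_inP[y Uy exy]]|].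
  by exists x, y.
by case=> x [y [Ux Uy exy]]; exists x => //; apply/exists_inP; exists y.
Qed.

Lemma imprimitivity_set_listing x : exists p (i : 'I_(imprimitivity e (D p))), x \in U i.
Proof.
have [p Dx] := listing_cover x.
by have [i Ui] := imprimitivity_set_cover (U_sets p) Dx; exists p, i.
Qed.

(** Around a closed walk the potential changes by 0 and, modulo [k], by the length of the walk. *)
Lemma potential_imprimitivity_dvd phi p :
  potential e (D r) phi -> k %| imprimitivity e (D p).
Proof.
move=> phi_arc; apply: dvdn_imprimitivity => y m _ yy.
have := digraph_power_potential phi_arc yy.
by rewrite subrr sub0r rpredN dvdzE !absz_nat.
Qed.

(** On one component, potential and class index differ by a constant modulo [k], because [k] divides
    the period there. *)
Lemma potential_imprimitivity_set phi p (i i' : 'I_(imprimitivity e (D p))) x x' :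
    potential e (D r) phi -> x \in U i -> x' \in U i' ->
  (k%:Z %| ((phi x' - phi x) - (i'%:Z - i%:Z))%R)%Z.
Proof.
move=> phi_arc Ux Ux'.
have [m xx'] := strong_walk (listing_strong p)
  (imprimitivity_set_sub (U_sets p) Ux) (imprimitivity_set_sub (U_sets p) Ux').
have d1 := digraph_power_potential phi_arc xx'.
have d2 : (k%:Z %| (i'%:Z - i%:Z - m%:Z)%R)%Z.
  apply: dvdz_trans (imprimitivity_set_walk (listing_strong p) (U_sets p) Ux Ux' xx').
  by rewrite dvdzE !absz_nat (potential_imprimitivity_dvd p phi_arc).
have -> : ((phi x' - phi x) - (i'%:Z - i%:Z) =
  (phi x' - phi x - m%:Z) - (i'%:Z - i%:Z - m%:Z))%R by ring.
exact: dvdzB.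
Qed.

Lemma arc_classes_potential (c : 'I_eta -> int) :
    (forall p, k %| imprimitivity e (D p)) ->
    (forall p q (i : 'I_(imprimitivity e (D p))) (j : 'I_(imprimitivity e (D q))),
       q = p.+1 :> nat -> (i, j) \in arc_classes e (@U p) (@U q) ->
       (k%:Z %| (i%:Z - j%:Z - c p)%R)%Z) ->
  exists phi, potential e (D r) phi.
Proof.
move=> k_dvd c_arc.
(* The potential will be class index plus offset [o]. An increment of 1 along an arc from class [i]
   of [D p] to class [j] of the next component requires the offset to grow by [i - j + 1], that is,
   by [c p + 1] modulo [k]. *)
pose o (q : 'I_eta) : int := (\sum_(p < eta | (p < q)%N) (c p + 1))%R.
have oS p q : q = p.+1 :> nat -> o q = (c p + 1 + o p)%R.
  move=> q_succ; rewrite /o (bigD1 p) ?q_succ ?ltnS //=; congr (_ + _)%R.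
  by apply: eq_bigl => s; rewrite ltnS andbC -ltn_neqAle.
have /fin_all_exists[phi phiE] : forall x, exists a : int,
    forall p (i : 'I_(imprimitivity e (D p))), x \in U i -> a = (i%:Z + o p)%R.
  move=> x; have [p [i Ui]] := imprimitivity_set_listing x.
  exists (i%:Z + o p)%R => p' i' Ui'.
  have eq_p := listing_inj (imprimitivity_set_sub (U_sets p') Ui')
                           (imprimitivity_set_sub (U_sets p) Ui).
  by case: p / eq_p i Ui => i Ui; rewrite (imprimitivity_set_inj (U_sets p') Ui Ui').
exists phi => x y exy.
have [p [i Ux]] := imprimitivity_set_listing x.
have [q [j Uy]] := imprimitivity_set_listing y.
rewrite (phiE _ _ _ Ux) (phiE _ _ _ Uy).
have Dx := imprimitivity_set_sub (U_sets p) Ux.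
have Dy := imprimitivity_set_sub (U_sets q) Uy.
have [eq_pq|q_succ] := listing_arc Dx Dy exy.
  case: q / eq_pq j Uy {Dy} => j Uy.
  have -> : (j%:Z + o p - (i%:Z + o p) - 1 = j%:Z - i%:Z - 1%N%:Z)%R by ring.
  apply: dvdz_trans (imprimitivity_set_walk (listing_strong p) (U_sets p) Ux Uy
    (digraph_power1 exy)).
  by rewrite dvdzE !absz_nat.
have d : (k%:Z %| (i%:Z - j%:Z - c p)%R)%Z.
  by apply: (c_arc p q) => //; apply/arc_classesP; exists x, y.
rewrite (oS _ _ q_succ).
have -> : (j%:Z + (c p + 1 + o p) - (i%:Z + o p) - 1 =
  - (i%:Z - j%:Z - c p))%R by ring.
by rewrite rpredN.
Qed.

(** The increments along two arcs between the same components agree modulo [k], which fixes [i - j].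
    Conversely, one reference arc per consecutive pair supplies the constants for the offsets. *)
Lemma potential_arc_classes :
  (exists phi, potential e (D r) phi) <->
  (forall p q : 'I_eta, q = p.+1 :> nat ->
     k %| imprimitivity e (D p) /\
     forall (i i' : 'I_(imprimitivity e (D p)))
            (j j' : 'I_(imprimitivity e (D q))),
       (i, j) \in arc_classes e (@U p) (@U q) ->
       (i', j') \in arc_classes e (@U p) (@U q) ->
       (i%:Z - j%:Z = i'%:Z - j'%:Z %[mod k%:Z])%Z).
Proof.
split=> [[phi phi_arc] p q q_succ|cond].
  split=> [|i i' j j']; first exact: potential_imprimitivity_dvd phi_arc.
  move=> /arc_classesP[x [y [Ux Uy exy]]] /arc_classesP[x' [y' [Ux' Uy' exy']]].
  have d1 := phi_arc _ _ exy; have d2 := phi_arc _ _ exy'.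
  have d3 := potential_imprimitivity_set phi_arc Ux Ux'.
  have d4 := potential_imprimitivity_set phi_arc Uy Uy'.
  apply/eqP; rewrite eqz_mod_dvd.
  have -> : (i%:Z - j%:Z - (i'%:Z - j'%:Z) =
    ((phi x' - phi x) - (i'%:Z - i%:Z)) - ((phi y' - phi y) - (j'%:Z - j%:Z))
    + (phi y' - phi x' - 1) - (phi y - phi x - 1))%R by ring.
  exact: (dvdzB (dvdzD (dvdzB d3 d4) d2) d1).
have /fin_all_exists[c c_arc] : forall p, exists a : int, forall q
    (i : 'I_(imprimitivity e (D p))) (j : 'I_(imprimitivity e (D q))),
    q = p.+1 :> nat -> (i, j) \in arc_classes e (@U p) (@U q) ->
    (k%:Z %| (i%:Z - j%:Z - a)%R)%Z.
  move=> p; have [lt_p1|ge_p1] := ltnP p.+1 eta; last first.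
    (* The last component has no successor, so any value would do. *)
    by exists 0%R => q i j q_succ; have := ltn_ord q; lia.
  pose q0 := Ordinal lt_p1; have [_ cond_pq] := cond p q0 erefl.
  have [x [y [Dx Dy exy]]] := @listing_succ_arc p q0 erefl.
  have [i0 Ux] := imprimitivity_set_cover (U_sets p) Dx.
  have [j0 Uy] := imprimitivity_set_cover (U_sets q0) Dy.
  exists (i0%:Z - j0%:Z)%R => q i j q_succ.
  have eq_q : q0 = q by apply: val_inj.
  case: q / eq_q j {q_succ} => j ij.
  rewrite -eqz_mod_dvd; apply/eqP; apply: cond_pq => //.
  by apply/arc_classesP; exists x, y.
apply: (arc_classes_potential _ c_arc) => p.
(* The condition only covers components with a successor; for [r] itself divisibility is trivial. *)
have [->//|neq] := eqVneq p r.
have lt_pr : p < r by rewrite ltn_neqAle neq -ltnS r_last ltn_ord.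
have lt_p1 : p.+1 < eta by move: lt_pr; rewrite -ltnS r_last.
by have [] := cond p (Ordinal lt_p1) erefl.
Qed.

End LinearListing.

Theorem theorem3p18 (T : finType) (e : rel T) (e_irr : irreflexive e)
    (e_lin : linearly_connected e)
    (eta : nat) (eta_ge2 : 2 <= eta)
    (D : 'I_eta -> {set T}) (D_list : linear_listing e D)
    (D_nontrivial : forall p : 'I_eta, 1 < #|D p|)
    (U : forall p : 'I_eta, 'I_(imprimitivity e (D p)) -> {set T})
    (U_sets : forall p : 'I_eta, imprimitivity_sets (U p))
    (r : 'I_eta) (r_last : r.+1 = eta)
    (G : rel T)
    (G_lim : graph_limit (fun m => competition_graph (digraph_power e m)) G) :
  union_of_complete_graphs G <->
  (forall p q : 'I_eta, q = p.+1 :> nat ->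
     imprimitivity e (D r) %| imprimitivity e (D p) /\
     forall (i i' : 'I_(imprimitivity e (D p)))
            (j j' : 'I_(imprimitivity e (D q))),
       (i, j) \in arc_classes e (U p) (U q) ->
       (i', j') \in arc_classes e (U p) (U q) ->
       (i%:Z - j%:Z = i'%:Z - j'%:Z %[mod (imprimitivity e (D r))%:Z])%Z).
Proof.
have [e_weak _] := e_lin.
(* Nontriviality of all components excludes sinks. *)
have out x : exists y, e x y.
  have [p Dx] := listing_cover D_list x.
  by have [y _ exy] := strong_out (listing_strong D_list p) (D_nontrivial p) Dx; exists y.
have reach x := listing_reach_last e_weak D_list x r_last.
apply: iff_trans.
  apply: (@union_of_complete_graphsP T G (meet_ahead e)).
  - exact: meet_ahead_refl.
  - exact: meet_ahead_sym.
  - by move=> u w; apply: graph_limit_competition out G_lim.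
apply: iff_trans.
  exact: (meet_ahead_trans_potential (listing_strong D_list r) (U_sets r)
            (D_nontrivial r) reach).
exact (potential_arc_classes e_weak D_list U_sets r_last).
Qed.
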